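(* In the setting of the context, let $\widehat\zeta\ne\zeta$ be an approximation to $\zeta$, let $\widehat\varphi_n=f_n(\widehat\zeta)$, and for $N\ge 0$ put $\beta_{0,N}:=-\sum_{n=0}^N\bar P_n\varphi_n$, $\sigma_N^2:=2\sum_{n=0}^N\lambda_np_n\varphi_n^2$, $\widehat\beta_{0,N}:=-\sum_{n=0}^N\bar P_n\widehat\varphi_n$, $\widehat\sigma_N^2:=2\sum_{n=0}^N\lambda_np_n\widehat\varphi_n^2$. Assume that $\beta_{0,N}$ and $\sigma_N^2$ converge to finite limits $\beta_0$ and $\sigma^2$, respectively, as $N\to\infty$. Then, with $E_{\mathrm{abs}}(\widehat\zeta):=\widehat\zeta-\zeta$: (a) $\widehat\beta_{0,N}=\beta_{0,N}-E_{\mathrm{abs}}(\widehat\zeta)\sum_{n=0}^N\bar P_nT_n^+$ for all $N\ge 0$; (b) as $N\to\infty$: if $T_{\infty 0}=\infty$ then $|\widehat\beta_{0,N}|\to\infty$; otherwise $\widehat\beta_{0,N}\to\beta_0-T_{\infty p}\,E_{\mathrm{abs}}(\widehat\zeta)$; (c) $\widehat\sigma_N^2=\sigma_N^2+4E_{\mathrm{abs}}(\widehat\zeta)\sum_{n=0}^NP_n\varphi_n+2\big(E_{\mathrm{abs}}(\widehat\zeta)\big)^2\sum_{n=0}^NP_nT_n^+$ for all $N\ge 0$; (d) $\widehat\sigma_N^2\to\infty$ as $N\to\infty$.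
   Context: Let $\{X(t)\}_{t\ge 0}$ be a continuous-time birth--death Markov chain on $\mathbb{N}_0=\{0,1,2,\dots\}$ with birth rates $\lambda_n>0$ ($n\ge 0$), death rates $\mu_n>0$ ($n\ge 1$) and $\mu_0=0$. Set $\pi_0=1$, $\pi_n=\frac{\lambda_0\cdots\lambda_{n-1}}{\mu_1\cdots\mu_n}$ for $n\ge1$. Standing assumption: $\sum_{n\ge 0} 1/(\lambda_n\pi_n)=\infty$ and $\sum_{n\ge 0}\pi_n<\infty$ (the process is uniquely determined by its rates and ergodic). The steady-state probabilities are $p_n=\pi_n/\sum_{j\ge 0}\pi_j$. Cost rates $c_n\in\mathbb{R}$ satisfy $\sum_n |c_n|p_n<\infty$, and $\zeta:=\sum_n c_np_n$. $P_n:=\sum_{j=0}^n p_j$ and $\bar P_n:=1-P_n$. With $\tau_n:=\min\{t\ge 0: X(t)=n\}$ and $\mathbb{E}_n$ the expectation given $X(0)=n$: $T_n^+:=\mathbb{E}_n[\tau_{n+1}]$, $T_{n0}:=\mathbb{E}_n[\tau_0]$, $T_{\infty 0}:=\lim_{n\to\infty}T_{n0}=\sum_{n\ge 0}\frac{\bar P_n}{\lambda_np_n}\in(0,\infty]$, and $T_{\infty p}:=\sum_{n\ge 0}\bar P_nT_n^+\in(0,\infty]$. For $z\in\mathbb{R}$, $f(z)$ is given by the forward recurrence $f_0(z)=\frac{z-c_0}{\lambda_0}$, $f_n(z)=\frac{z-c_n}{\lambda_n}+\frac{\mu_n}{\lambda_n}f_{n-1}(z)$, $n\ge 1$. Put $\varphi_n:=f_n(\zeta)$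 (the marginal relative cost, i.e. $\varphi_n=b_{n+1}-b_n$ for solutions $b$ of Poisson's equation). *)

(* Defs.v *)
From HB Require Import structures.
From mathcomp Require Export all_boot all_order all_algebra.
From mathcomp Require Export all_classical all_reals all_analysis.
Export Order.TTheory GRing.Theory Num.Theory.
Export numFieldNormedType.Exports.

Set Implicit Arguments.
Unset Strict Implicit.
Unset Printing Implicit Defensive.

Local Open Scope classical_set_scope.
Local Open Scope ring_scope.

Definition bd_rate (R : realType) (lambda mu : nat -> R) (i j : nat) : R :=
  if j == i.+1 then lambda i
  else if i == j.+1 then mu i
  else if j == i then - (lambda i + mu i)
  else 0.

(* [Pr i] is the law under which the chain starts at [i].  The Markov property
   is written in product form, so that it does not condition on null events;
   as [Pr i] and [Pr (x k)] belong to one family, it includes time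
   homogeneity.  The function [fun i j h => Pr i (X h = j)] is the transition
   function, and its right derivative at 0 is the matrix of rates.  Only the
   times [t >= 0] are constrained. *)
Record birth_death_chain (R : realType) (d : measure_display)
    (Omega : measurableType d) (lambda mu : nat -> R)
    (Pr : nat -> probability Omega R) (X : R -> {mfun Omega >-> nat}) : Prop :=
  BirthDeathChain {
  bd_init : forall i : nat, Pr i (X 0 @^-1` [set i]) = 1%E ;
  (* right-continuity for the discrete topology of the state space *)
  bd_rightcont : forall (w : Omega) (t : R), 0 <= t ->
    \forall s \near t^'+, X s w = X t w ;
  bd_markov : forall (i k : nat) (t : nat -> R) (x : nat -> nat)
      (s : R) (j : nat),
    0 <= t 0%N -> {homo t : m n / (m <= n)%N >-> m <= n} -> 0 <= s ->
    let past := \bigcap_(l in [set l | (l <= k)%N]) (X (t l) @^-1` [set x l]) in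
    Pr i (past `&` X (t k + s) @^-1` [set j])
      = (Pr i past * Pr (x k) (X s @^-1` [set j]))%E ;
  bd_rates : forall i j : nat,
    (fine (Pr i (X h @^-1` [set j])) - (i == j)%:R) / h @[h --> 0^'+]
      --> bd_rate lambda mu i j
  }.

(* [+oo] when the state [n] is never visited; by right-continuity the infimum
   is a minimum otherwise. *)
Definition hitting_time (R : realType) (d : measure_display)
    (Omega : measurableType d) (X : R -> {mfun Omega >-> nat})
    (n : nat) (w : Omega) : \bar R :=
  ereal_inf [set t%:E | t in [set t : R | 0 <= t /\ X t w = n]].

Definition mean_hitting_time (R : realType) (d : measure_display)
    (Omega : measurableType d) (Pr : nat -> probability Omega R)
    (X : R -> {mfun Omega >-> nat}) (i n : nat) : \bar R :=
  (\int[Pr i]_w hitting_time X n w)%E.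

Definition T_plus (R : realType) (d : measure_display)
    (Omega : measurableType d) (Pr : nat -> probability Omega R)
    (X : R -> {mfun Omega >-> nat}) (n : nat) : \bar R :=
  mean_hitting_time Pr X n n.+1.

Definition T_infty_0 (R : realType) (d : measure_display)
    (Omega : measurableType d) (Pr : nat -> probability Omega R)
    (X : R -> {mfun Omega >-> nat}) : \bar R :=
  limn (fun n => mean_hitting_time Pr X n 0).

Definition bd_pi (R : realType) (lambda mu : nat -> R) (n : nat) : R :=
  (\prod_(0 <= k < n) lambda k) / (\prod_(1 <= k < n.+1) mu k).

Definition bd_p (R : realType) (lambda mu : nat -> R) (n : nat) : R :=
  bd_pi lambda mu n / limn (series (bd_pi lambda mu)).

Definition bd_P (R : realType) (lambda mu : nat -> R) (n : nat) : R :=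
  \sum_(0 <= j < n.+1) bd_p lambda mu j.

Definition bd_Pbar (R : realType) (lambda mu : nat -> R) (n : nat) : R :=
  1 - bd_P lambda mu n.

Definition T_infty_p (R : realType) (d : measure_display)
    (Omega : measurableType d) (lambda mu : nat -> R)
    (Pr : nat -> probability Omega R) (X : R -> {mfun Omega >-> nat}) :
    \bar R :=
  (\sum_(0 <= n <oo) (bd_Pbar lambda mu n)%:E * T_plus Pr X n)%E.

Definition mean_cost (R : realType) (lambda mu c : nat -> R) : R :=
  limn (series (fun n => c n * bd_p lambda mu n)).

Fixpoint fwd (R : realType) (lambda mu c : nat -> R) (z : R) (n : nat) : R :=
  match n with
  | 0 => (z - c 0%N) / lambda 0%N
  | m.+1 => (z - c m.+1) / lambda m.+1
            + mu m.+1 / lambda m.+1 * fwd lambda mu c z m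
  end.

(* With [phi n := fwd lambda mu c z n], the truncated bias and variance; the
   exact ones are at [z = mean_cost lambda mu c]. *)
Definition beta0_trunc (R : realType) (lambda mu c : nat -> R) (z : R)
    (N : nat) : R :=
  - \sum_(0 <= n < N.+1) bd_Pbar lambda mu n * fwd lambda mu c z n.

Definition sigma2_trunc (R : realType) (lambda mu c : nat -> R) (z : R)
    (N : nat) : R :=
  2 * \sum_(0 <= n < N.+1)
        lambda n * bd_p lambda mu n * fwd lambda mu c z n ^+ 2.

(* Main.v *)
(* Everything reduces to T_n^+ = (pi_0 + .. + pi_n) / (lambda_n pi_n), since
   varying z in the recurrence changes f_n(z) by exactly (z' - z) T_n^+, so that
   (a) and (c) are algebra, (d) follows from (E s)^2 <= 2 (f + E s)^2 + 2 f^2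
   (with E = Eabs, s = T_n^+), and (b) also needs an upper bound on T_{n0}.

   Hitting times are approximated by those of the skeletons X(0), X(h), X(2h), ..:
   the skeleton obeys an exact one-step recursion, so paths that hit the target
   and come back within one step never have to be estimated, and by
   right-continuity min(tau, T) is the limit of its skeleton versions as h -> 0.
   Up to an error o(h) per step, the skeleton recursion is the one of the
   generator Q on every finite block of states, and E_i[min(tau, T)] is at most v_i for
   every v >= 0 with Q v <= -1 off the target (minimum principle).  This bounds
   T_n^+ and T_{n0} from above.  The equality for T_n^+ comes from the flux
   identity d/dt sum_{i <= n} pi_i P_i(tau > t) = - lambda_n pi_n P_n(tau > t). *)

Require Import Defs.
From mathcomp Require Import all_boot all_order all_algebra.
From mathcomp Require Import all_classical all_reals all_analysis.
From mathcomp Require Import measurable_realfun ring lra zify.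

Local Open Scope classical_set_scope.
Local Open Scope ring_scope.

(** * Markov property of the skeleton chain and avoidance of a target *)

Section grid_chain.
Context (R : realType) (d : measure_display) (Omega : measurableType d).
Context (lambda mu : nat -> R) (Pr : nat -> probability Omega R).
Context (X : R -> {mfun Omega >-> nat}).
Hypothesis chainX : birth_death_chain lambda mu Pr X.

Definition trans (h : R) (i j : nat) : R := fine (Pr i (X h @^-1` [set j])).

Definition cylinder (h : R) (x : nat -> nat) (a : nat) : set Omega :=
  \bigcap_(l in [set l | (l <= a)%N]) (X (l%:R * h) @^-1` [set x l]).

(** The conditions are indexed from [r = 0], at time [(a + 1) * h], so the same [C] describes the
    event after a restart at time 0. *)
Definition future (h : R) (a b : nat) (C : nat -> set nat) : set Omega :=
  [set w | forall r, (r < b)%N -> C r (X ((a + r).+1%:R * h) w)].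

Definition avoid (h : R) (y k : nat) : set Omega :=
  [set w | forall r, (r <= k)%N -> X (r%:R * h) w <> y].

Definition avoid_prob (h : R) (y i k : nat) : R := fine (Pr i (avoid h y k)).

Lemma measurable_X t (B : set nat) : measurable (X t @^-1` B).
Proof. by rewrite -[X in measurable X]setTI; exact: measurable_funPT. Qed.

Lemma measurable_cylinder h x a : measurable (cylinder h x a).
Proof. by apply: bigcap_measurableType => // l _; exact: measurable_X. Qed.

Lemma measurable_future h a b C : measurable (future h a b C).
Proof.
have -> : future h a b C =
    \bigcap_(r in [set r | (r < b)%N]) (X ((a + r).+1%:R * h) @^-1` C r) by [].
by apply: bigcap_measurableType => // l _; exact: measurable_X.
Qed.

Lemma measurable_avoid h y k : measurable (avoid h y k).
Proof.
have -> : avoid h y k =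
    \bigcap_(r in [set r | (r <= k)%N]) (X (r%:R * h) @^-1` ~` [set y]) by [].
by apply: bigcap_measurableType => // l _; exact: measurable_X.
Qed.

Lemma cylinderS h x a z :
  cylinder h (fun l => if (l <= a)%N then x l else z) a.+1 =
  cylinder h x a `&` X (a.+1%:R * h) @^-1` [set z].
Proof.
apply/seteqP; split=> w.
  move=> H; split=> [l /= la|]; first by have := H l (leqW la); rewrite /= la.
  by have := H a.+1 (leqnn _); rewrite /= ltnn.
move=> [H1 H2] l /=; rewrite leq_eqVlt => /predU1P[->|]; first by rewrite ltnn.
by rewrite ltnS => la; rewrite la; exact: H1.
Qed.

Lemma future_cons h a b C x :
  cylinder h x a `&` future h a b.+1 C =
  \bigcup_(z in C 0%N)
    (cylinder h (fun l => if (l <= a)%N then x l else z) a.+1 `&`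
     future h a.+1 b (fun r => C r.+1)).
Proof.
apply/seteqP; split=> w.
  move=> [H1 H2]; exists (X (a.+1%:R * h) w).
    by have := H2 0%N isT; rewrite addn0.
  rewrite cylinderS; split=> [//|r rb]; have := H2 r.+1 rb.
  by rewrite addSnnS.
move=> [z Cz]; rewrite cylinderS => -[[H1 H2] H3]; split=> // -[|r] rb.
  by rewrite addn0 H2.
by rewrite -addSnnS; exact: H3.
Qed.

Lemma cylinder0 h i x : x 0%N = i -> Pr i (cylinder h x 0) = 1%E.
Proof.
move=> <-; rewrite -(bd_init chainX (x 0%N)); congr (Pr _ _).
apply/seteqP; split=> w; first by move=> /(_ 0%N isT); rewrite mul0r.
by move=> H [|//] _; rewrite mul0r.
Qed.

Lemma cylinder_markov h x a z i : 0 <= h ->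
  Pr i (cylinder h x a `&` X (a.+1%:R * h) @^-1` [set z]) =
  (Pr i (cylinder h x a) * Pr (x a) (X h @^-1` [set z]))%E.
Proof.
move=> h0.
have := @bd_markov _ _ _ _ _ _ _ chainX i a (fun l => l%:R * h) x h z.
rewrite (_ : _ + h = a.+1%:R * h); last by rewrite -natr1 mulrDl mul1r.
apply => //; first by rewrite mul0r.
by move=> m n mn; rewrite ler_wpM2r// ler_nat.
Qed.

(** [bd_markov] reaches a single later time; induction on [b] extends it to finitely many. Both
    sides are expanded over the value [z] at the first later time, and beyond the factor for the
    past cylinder the expansion depends on the past only through [x a]. *)
Lemma future_markov h b a C x i : 0 <= h ->
  Pr i (cylinder h x a `&` future h a b C) =
  (Pr i (cylinder h x a) *
   Pr (x a) (cylinder h (fun=> x a) 0 `&` future h 0 b C))%E.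
Proof.
move=> h0; elim: b => [|b IH] in a C x i *.
  have E c : future h c 0 C = setT by apply/seteqP; split.
  by rewrite !E !setIT cylinder0// mule1.
have expand a' x' i' :
    Pr i' (cylinder h x' a' `&` future h a' b.+1 C) =
    (Pr i' (cylinder h x' a') * \sum_(z <oo | z \in C 0%N)
      (Pr (x' a') (X h @^-1` [set z]) *
       Pr z (cylinder h (fun=> z) 0 `&` future h 0 b (fun r => C r.+1))))%E.
  rewrite future_cons measure_bigcup; last 2 first.
  - by move=> z _; apply: measurableI; [exact: measurable_cylinder|
      exact: measurable_future].
  - move=> z1 z2 _ _ [w]; rewrite !cylinderS /=.
    by move=> [[[_ <-] _] [[_ <-] _]].
  transitivity (\sum_(z <oo | z \in C 0%N) (Pr i' (cylinder h x' a') *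
      (Pr (x' a') (X h @^-1` [set z]) *
       Pr z (cylinder h (fun=> z) 0 `&` future h 0 b (fun r => C r.+1)))))%E.
    apply: eq_eseriesr => z _.
    apply: (etrans (IH a'.+1 _ _ i')).
    by rewrite ltnn cylinderS cylinder_markov// muleA.
  rewrite -(@fineK _ (Pr i' _)) ?fin_num_measure//; last exact: measurable_cylinder.
  by rewrite nneseriesZl// => z _; rewrite mule_ge0.
by rewrite !expand cylinder0// mul1e.
Qed.

Lemma avoid_prob_ge0 h y i k : 0 <= avoid_prob h y i k.
Proof. exact: fine_ge0. Qed.

Lemma avoid_prob_le1 h y i k : avoid_prob h y i k <= 1.
Proof.
rewrite -[leRHS]/(fine 1%E) fine_le ?fin_num_measure//; first exact: measurable_avoid.
by apply: probability_le1; exact: measurable_avoid.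
Qed.

Lemma probability_start i (A : set Omega) : measurable A ->
  Pr i A = Pr i (X 0 @^-1` [set i] `&` A).
Proof.
move=> mA; have mX := measurable_X 0 [set i].
rewrite {1}(_ : A = (X 0 @^-1` [set i] `&` A) `|` (A `\` X 0 @^-1` [set i])).
  rewrite measureU; [|exact: measurableI|exact: measurableD|]; last first.
    by apply/seteqP; split=> w //= -[[? ?] [? []]].
  rewrite [X in (_ + X)%E](_ : _ = 0%E) ?adde0//.
  apply/eqP; rewrite eq_le measure_ge0 andbT.
  apply: (@le_trans _ _ (Pr i (~` (X 0 @^-1` [set i])))).
    apply: le_measure; rewrite ?inE; [exact: measurableD|exact: measurableC|].
    exact: subDsetr.
  by rewrite probability_setC// (bd_init chainX) subee.
apply/seteqP; split=> w /=; last by move=> [[]|[]].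
by move=> Aw; have [|] := eqVneq (X 0 w) i => [|/eqP] H; [left|right].
Qed.

Lemma avoid_prob0 h (y i : nat) : i != y -> avoid_prob h y i 0 = 1.
Proof.
move=> iy; rewrite /avoid_prob probability_start; last exact: measurable_avoid.
rewrite (_ : _ `&` _ = X 0 @^-1` [set i]) ?(bd_init chainX)//.
apply/seteqP; split=> w; first by move=> [].
move=> Xi; split=> // -[|//] _; rewrite mul0r Xi; exact/eqP.
Qed.

Lemma avoid_prob_target h y k : avoid_prob h y y k = 0.
Proof.
rewrite /avoid_prob probability_start; last exact: measurable_avoid.
rewrite (_ : _ `&` _ = set0) ?measure0//.
by apply/seteqP; split=> w //= [Xi /(_ 0%N isT)]; rewrite mul0r.
Qed.

(** The first two values [i, j] form a cylinder, to which [future_markov] applies. For [j = y] both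
    sides vanish, so sums over [j] may include the target. *)
Lemma avoid_first_step h (y i j k : nat) : 0 <= h -> i != y ->
  fine (Pr i (avoid h y k.+1 `&` X h @^-1` [set j])) =
  trans h i j * avoid_prob h y j k.
Proof.
move=> h0 iy.
have [<-|jy] := eqVneq j y.
  rewrite avoid_prob_target mulr0 (_ : _ `&` _ = set0) ?measure0//.
  by apply/seteqP; split=> w //= [/(_ 1%N isT)]; rewrite mul1r.
pose C := (fun _ : nat => ~` [set y]).
pose x l := if (l <= 0)%N then i else j.
rewrite probability_start; last first.
  by apply: measurableI; [exact: measurable_avoid|exact: measurable_X].
rewrite [X in Pr i X](_ : _ = cylinder h x 1 `&` future h 1 k C); last first.
  apply/seteqP; split=> w.
    move=> [X0 [H X1]]; split; last by move=> r rk; apply: H; rewrite add1n.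
    by move=> [|[|//]] _ /=; rewrite ?mul0r ?mul1r.
  rewrite cylinderS => -[[/(_ 0%N isT)/=]]; rewrite mul0r mul1r => X0 X1 H.
  split=> //; split=> // -[|[|r]] rk; rewrite ?mul0r ?mul1r.
  - by rewrite X0; exact/eqP.
  - by rewrite X1; exact/eqP.
  - by apply: H.
rewrite future_markov// cylinderS cylinder_markov// (cylinder0 _ i)// mul1e.
rewrite fineM ?fin_num_measure//; try exact: measurable_X; last first.
  by apply: measurableI; [exact: measurable_cylinder|exact: measurable_future].
congr (_ * fine _); rewrite [RHS]probability_start; last exact: measurable_avoid.
congr (Pr _ _); apply/seteqP; split=> w.
  move=> [/(_ 0%N isT)/=]; rewrite mul0r => X0 H; split=> // -[|r] rk.
    by rewrite mul0r X0; exact/eqP.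
  by apply: H.
move=> [X0 H]; split; first by move=> [|//] _; rewrite mul0r.
by move=> r rk; exact: H.
Qed.

Lemma probability_split_value i (A : set Omega) t N : measurable A ->
  fine (Pr i A) = \sum_(0 <= j < N) fine (Pr i (A `&` X t @^-1` [set j]))
    + fine (Pr i (A `&` X t @^-1` [set j | (N <= j)%N])).
Proof.
move=> mA; elim: N => [|N ->].
  rewrite big_nil add0r; congr (fine (Pr i _)).
  by apply/seteqP; split=> w // [].
rewrite big_nat_recr//= -addrA; congr (_ + _).
rewrite -fineD ?fin_num_measure//; try by apply: measurableI => //; exact: measurable_X.
rewrite -measureU; try by apply: measurableI => //; exact: measurable_X.
  congr (fine (Pr i _)); apply/seteqP; split=> w /=.
    move=> [Aw]; rewrite leq_eqVlt => /predU1P[->|]; [left|right]; split=> //.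
  by move=> [[? ->]|[? /ltnW]].
by apply/seteqP; split=> w //= -[[_ ->] [_]]; rewrite ltnn.
Qed.

Lemma trans_ge0 h i j : 0 <= trans h i j.
Proof. exact: fine_ge0. Qed.

Lemma trans_tail h i N :
  fine (Pr i (X h @^-1` [set j | (N <= j)%N])) = 1 - \sum_(0 <= j < N) trans h i j.
Proof.
have := @probability_split_value i setT h N measurableT.
rewrite probability_setT setTI /= => ->.
by under eq_bigr do rewrite setTI; rewrite addrC addKr.
Qed.

Lemma trans_sum_le1 h i N : \sum_(0 <= j < N) trans h i j <= 1.
Proof. by rewrite -subr_ge0 -trans_tail; exact: fine_ge0. Qed.

(** The rates are known entry by entry only, hence the finite sums: jumps to [N] or beyond are
    discarded here and counted as certain survival in [avoid_prob_le]. *)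
Lemma avoid_prob_ge h (y i k N : nat) : 0 <= h -> i != y ->
  \sum_(0 <= j < N) trans h i j * avoid_prob h y j k <= avoid_prob h y i k.+1.
Proof.
move=> h0 iy; rewrite {2}/avoid_prob (@probability_split_value _ _ h N);
  last exact: measurable_avoid.
under [X in _ <= X + _]eq_bigr do rewrite avoid_first_step//.
by rewrite lerDl; exact: fine_ge0.
Qed.

Lemma avoid_prob_le h (y i k N : nat) : 0 <= h -> i != y ->
  avoid_prob h y i k.+1 <= \sum_(0 <= j < N) trans h i j * avoid_prob h y j k
    + (1 - \sum_(0 <= j < N) trans h i j).
Proof.
move=> h0 iy; rewrite {1}/avoid_prob (@probability_split_value _ _ h N);
  last exact: measurable_avoid.
under [X in X + _ <= _]eq_bigr do rewrite avoid_first_step//.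
rewrite lerD2l -trans_tail fine_le ?fin_num_measure//; try exact: measurable_X.
  by apply: measurableI; [exact: measurable_avoid|exact: measurable_X].
apply: le_measure; rewrite ?inE; last exact: subIsetr.
  by apply: measurableI; [exact: measurable_avoid|exact: measurable_X].
exact: measurable_X.
Qed.

Lemma avoid_prob_nonincr h y i k : avoid_prob h y i k.+1 <= avoid_prob h y i k.
Proof.
rewrite fine_le ?fin_num_measure//; try exact: measurable_avoid.
apply: le_measure; rewrite ?inE; try exact: measurable_avoid.
by move=> w H r rk; apply: H; exact: leqW.
Qed.

(** * Approximation of one skeleton step by the generator *)

(* Bounds [(trans h - 1 - h Q) / h] on the rows below [N]; a row [i] is cut at
   the column [i.+1], beyond which [Q] vanishes. *)
Definition gen_error (h : R) (N : nat) : R :=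
  \sum_(0 <= i < N) \sum_(0 <= j < i.+2)
    `|(trans h i j - (i == j)%:R) / h - bd_rate lambda mu i j|.

Lemma gen_error_cvg0 N : gen_error h N @[h --> 0^'+] --> 0.
Proof.
have cvg0_sum M (f : nat -> R -> R) : (forall i, f i h @[h --> 0^'+] --> 0) ->
    \sum_(0 <= i < M) f i h @[h --> 0^'+] --> 0.
  move=> f0; elim: M => [|M IH].
    by under eq_fun do rewrite big_geq//; exact: cvg_cst.
  under eq_fun do rewrite big_nat_recr//=.
  by have := cvgD IH (f0 M); rewrite addr0; apply.
apply: (cvg0_sum) => i; apply: (cvg0_sum) => j.
have := cvg_norm (cvgB (@bd_rates _ _ _ _ _ _ _ chainX i j)
  (cvg_cst (bd_rate lambda mu i j))).
by rewrite subrr normr0; apply.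
Qed.

Hypothesis mu0 : mu 0%N = 0.

(** At [i = 0] the truncated predecessor makes the death term vanish. *)
Definition generator (v : nat -> R) (i : nat) : R :=
  lambda i * (v i.+1 - v i) + mu i * (v i.-1 - v i).

Lemma generatorE v i :
  \sum_(0 <= j < i.+2) bd_rate lambda mu i j * v j = generator v i.
Proof.
rewrite /generator; case: i => [|i].
  rewrite !big_nat_recr//= big_geq// add0r /bd_rate /= mu0.
  by ring.
rewrite !big_nat_recr//= big_nat big1 => [|j ji].
  have -> : bd_rate lambda mu i.+1 i = mu i.+1.
    by rewrite /bd_rate eqxx; case: eqP => //; lia.
  have -> : bd_rate lambda mu i.+1 i.+1 = - (lambda i.+1 + mu i.+1).
    by rewrite /bd_rate eqxx; case: eqP => //; lia.
  have -> : bd_rate lambda mu i.+1 i.+2 = lambda i.+1.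
    by rewrite /bd_rate eqxx.
  by ring.
rewrite /bd_rate; case: eqP => [|_]; first lia.
by case: eqP => [|_]; [lia|case: eqP => [|_]; [lia|rewrite mul0r]].
Qed.

Lemma delta_sum (v : nat -> R) i :
  \sum_(0 <= j < i.+2) (i == j)%:R * v j = v i.
Proof.
rewrite !big_nat_recr//= eqxx mul1r big_nat big1 => [|j ji].
  by case: eqP => [|_]; [lia|rewrite mul0r addr0 add0r].
by case: eqP => [|_]; [lia|rewrite mul0r].
Qed.

(** Each summand of the difference is [h] times an entry of the error matrix times [w j], and row
    [i] is one of the nonnegative rows summed in [gen_error]. *)
Lemma trans_approx h N i W (w : nat -> R) : 0 < h -> (i < N)%N ->
  (forall j, (j < i.+2)%N -> `|w j| <= W) ->
  `|\sum_(0 <= j < i.+2) trans h i j * w j - (w i + h * generator w i)|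
    <= h * (gen_error h N * W).
Proof.
move=> h0 iN wW; rewrite -generatorE -{1}(delta_sum w i) mulr_sumr -big_split/= -sumrB.
have W0 : 0 <= W by apply: le_trans (wW 0%N _).
apply: (@le_trans _ _ (\sum_(0 <= j < i.+2)
   h * (`|(trans h i j - (i == j)%:R) / h - bd_rate lambda mu i j| * W))).
  apply: le_trans (ler_norm_sum _ _ _) _.
  rewrite !big_nat ler_sum// => j /andP[_ ji].
  rewrite (_ : _ - _ =
      h * (((trans h i j - (i == j)%:R) / h - bd_rate lambda mu i j) * w j)).
    by rewrite !normrM (gtr0_norm h0) ler_pM2l// ler_wpM2l// wW.
  by field; rewrite gt_eqF.
rewrite -mulr_sumr ler_pM2l// -mulr_suml ler_wpM2r//.
rewrite /gen_error [leRHS]big_mkord (bigD1 (Ordinal iN))//= lerDl.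
by apply: sumr_ge0 => k _; apply: sumr_ge0.
Qed.

Lemma gen_error_ge0 h N : 0 <= gen_error h N.
Proof. by apply: sumr_ge0 => k _; apply: sumr_ge0. Qed.

(** This is [trans_approx] for the constant function 1, which the generator annihilates. *)
Lemma trans_defect h N i : 0 < h -> (i < N)%N ->
  1 - \sum_(0 <= j < i.+2) trans h i j <= h * gen_error h N.
Proof.
move=> h0 iN.
have := @trans_approx h N i 1 (fun=> 1) h0 iN.
rewrite /generator !(subrr, mulr0, addr0, mulr1).
under eq_bigr do rewrite mulr1.
rewrite distrC => H; apply: le_trans (ler_norm _) _; apply: H => j _.
by rewrite normr1.
Qed.

(** * Minimum principle for the skeleton *)

(* The mean of the skeleton version of [min(tau, h * k)]. *)
Definition occupation (h : R) (y i k : nat) : R :=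
  h * \sum_(0 <= l < k) avoid_prob h y i l.

Lemma occupation_le h y i k : 0 <= h -> occupation h y i k <= h * k%:R.
Proof.
move=> h0; rewrite ler_wpM2l//.
apply: (@le_trans _ _ (\sum_(0 <= l < k) 1)); last first.
  by rewrite sumr_const_nat subn0.
by apply: ler_sum => l _; exact: avoid_prob_le1.
Qed.

(** The current step contributes [h], the chain being off [y]; a jump to [N] or beyond is charged
    the whole remaining time [h * k]. *)
Lemma occupation_step h (y i k : nat) N : 0 <= h -> i != y ->
  occupation h y i k.+1 <= h + \sum_(0 <= j < N) trans h i j * occupation h y j k
    + (1 - \sum_(0 <= j < N) trans h i j) * (h * k%:R).
Proof.
move=> h0 iy; rewrite {1}/occupation big_nat_recl// mulrDr avoid_prob0// mulr1 -addrA.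
rewrite lerD2l.
apply: (@le_trans _ _ (h * \sum_(0 <= l < k)
   (\sum_(0 <= j < N) trans h i j * avoid_prob h y j l
    + (1 - \sum_(0 <= j < N) trans h i j)))).
  by rewrite ler_wpM2l// ler_sum// => l _; exact: avoid_prob_le.
rewrite big_split/= mulrDr sumr_const_nat subn0 lerD//; last first.
  by rewrite -mulr_natr; lra.
rewrite exchange_big/= mulr_sumr ler_sum// => j _.
by rewrite /occupation -mulr_sumr; lra.
Qed.

(* Jumps over [N] are harmless: they have probability [O(h * gen_error)], and the
   occupation is at most [T]. *)
Lemma occupation_supersolution h y N K V T (v : nat -> R) : 0 < h ->
  (forall j, (j <= N)%N -> 0 <= v j <= V) ->
  (forall i, (i < N)%N -> i != y -> generator v i <= -1) ->
  (forall k, (k <= K)%N -> occupation h y N k <= v N) ->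
  h * K%:R <= T ->
  forall k i, (k <= K)%N -> (i <= N)%N ->
  occupation h y i k <= v i + h * k%:R * (gen_error h N * (V + T)).
Proof.
move=> h0 v0V gen_v occN hKT.
have T0 : 0 <= T by apply: le_trans hKT; rewrite mulr_ge0 ?(ltW h0) ?ler0n.
have V0 : 0 <= V by have /andP[] := v0V 0%N (leq0n _); exact: le_trans.
have e0 := gen_error_ge0 h N.
set e := gen_error h N * (V + T).
have e_ge0 : 0 <= e by rewrite mulr_ge0// addr_ge0.
elim=> [|k IH] i kK iN.
  rewrite /occupation big_geq// !mulr0 mul0r addr0.
  by have /andP[] := v0V i iN.
have nonneg : 0 <= h * k.+1%:R * e.
  exact: (mulr_ge0 (mulr_ge0 (ltW h0) (ler0n _ _)) e_ge0).
have [E|iy] := eqVneq i y.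
  have /andP[vi _] := v0V i iN.
  rewrite {1}E /occupation big1 ?mulr0; last by move=> l _; exact: avoid_prob_target.
  exact: addr_ge0.
move: iN; rewrite leq_eqVlt => /predU1P[->|iN].
  by apply: le_trans (occN _ kK) _; rewrite lerDl.
have kK' := ltnW kK.
apply: le_trans (@occupation_step h y i k i.+2 (ltW h0) iy) _.
have S1 : \sum_(0 <= j < i.+2) trans h i j <= 1 by exact: trans_sum_le1.
have sum_le : \sum_(0 <= j < i.+2) trans h i j * occupation h y j k <=
    \sum_(0 <= j < i.+2) trans h i j * v j + h * k%:R * e.
  apply: (@le_trans _ _ (\sum_(0 <= j < i.+2)
      (trans h i j * v j + trans h i j * (h * k%:R * e)))).
    rewrite !big_nat ler_sum// => j /andP[_ ji].
    rewrite -mulrDr ler_wpM2l ?trans_ge0// IH//.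
    by apply: leq_trans iN; rewrite -ltnS.
  rewrite big_split/= lerD2l -mulr_suml ler_piMl//.
  by exact: (mulr_ge0 (mulr_ge0 (ltW h0) (ler0n _ _)) e_ge0).
have approx := @trans_approx h N i V v h0 iN.
have {}approx : \sum_(0 <= j < i.+2) trans h i j * v j - (v i + h * generator v i)
    <= h * (gen_error h N * V).
  apply: le_trans (ler_norm _) _; apply: approx => j ji.
  have jN : (j <= N)%N by apply: leq_trans iN; rewrite -ltnS.
  by have /andP[vj0 vjV] := v0V j jN; rewrite ger0_norm.
have gv : h * generator v i <= - h.
  by rewrite -[leRHS]mulrN1 ler_pM2l// gen_v.
have defect : (1 - \sum_(0 <= j < i.+2) trans h i j) * (h * k%:R) <=
    h * gen_error h N * T.
  apply: ler_pM.
  - by rewrite subr_ge0.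
  - by rewrite mulr_ge0// ltW.
  - exact: trans_defect.
  - by apply: le_trans hKT; rewrite ler_pM2l// ler_nat.
(* The [h] spent in the step cancels against [h * generator v i <= - h]; the errors from [approx]
   and [defect] add up to one more [h * e]. *)
rewrite -natr1 mulrDr mulr1 mulrDl {2}/e.
lra.
Qed.

(** Markov's inequality: survival is nonincreasing in time, so each of the [k] summands of the
    occupation is at least its value at [k]. *)
Lemma avoid_prob_le_occupation h y i k : 0 <= h ->
  h * k%:R * avoid_prob h y i k <= occupation h y i k.
Proof.
move=> h0; rewrite -mulrA ler_wpM2l//.
rewrite mulr_natl -[k in _ *+ k]subn0 -sumr_const_nat !big_nat ler_sum// => l /andP[_ lk].
apply: (@homo_leq _ (avoid_prob h y i) (fun a b => b <= a)) (ltnW lk).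
- by [].
- by move=> a b c ab bc; exact: le_trans bc ab.
- by move=> n; exact: avoid_prob_nonincr.
Qed.

(** * Detailed balance and the flux identity *)

Hypothesis lambda_gt0 : forall n, 0 < lambda n.
Hypothesis mu_gt0 : forall n, 0 < mu n.+1.

Local Notation pi_ := (bd_pi lambda mu).

Lemma bd_pi_gt0 n : 0 < pi_ n.
Proof.
rewrite /bd_pi divr_gt0//; first exact: prodr_gt0.
by rewrite big_add1/= prodr_gt0.
Qed.

Lemma bd_pi_balance n : mu n.+1 * pi_ n.+1 = lambda n * pi_ n.
Proof.
rewrite /bd_pi [\prod_(0 <= k < n.+1) _]big_nat_recr//=.
rewrite [\prod_(1 <= k < n.+2) _]big_nat_recr//=.
have prod0 : \prod_(1 <= k < n.+1) mu k != 0.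
  by rewrite gt_eqF// big_add1/= prodr_gt0.
by field; rewrite prod0 gt_eqF.
Qed.

(** By detailed balance the flows between neighbours inside the block cancel; only the edge from [n]
    to [n.+1] remains. *)
Lemma generator_flux (v : nat -> R) n :
  \sum_(0 <= i < n.+1) pi_ i * generator v i = lambda n * pi_ n * (v n.+1 - v n).
Proof.
elim: n => [|n IH].
  by rewrite big_nat1 /generator mu0; ring.
rewrite big_nat_recr//= IH /generator -bd_pi_balance/=.
ring.
Qed.

(** Discrete flux identity: up to the generator error, a step lowers the surviving mass by at most
    [h * lambda n * pi_ n] times the survival from [n], since survival from [n.+1] is 0. These
    losses add up to the occupation. *)
Lemma avoid_flux_ge h n K : 0 < h ->
  \sum_(0 <= i < n.+1) pi_ i
    - lambda n * pi_ n * occupation h n.+1 n K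
    - h * K%:R * (gen_error h n.+1 * \sum_(0 <= i < n.+1) pi_ i)
  <= \sum_(0 <= i < n.+1) pi_ i * avoid_prob h n.+1 i K.
Proof.
move=> h0; elim: K => [|K IH].
  rewrite /occupation [\sum_(0 <= l < 0) _]big_geq// !mulr0 mul0r !subr0.
  rewrite le_eqVlt; apply/orP; left; apply/eqP.
  rewrite !big_nat; apply: eq_bigr => i /andP[_ ilt].
  by rewrite avoid_prob0 ?mulr1// ltn_eqF.
have step i : (i < n.+1)%N ->
    avoid_prob h n.+1 i K + h * generator (avoid_prob h n.+1 ^~ K) i
      - h * gen_error h n.+1 <= avoid_prob h n.+1 i K.+1.
  move=> ilt.
  have iy : i != n.+1 by rewrite ltn_eqF.
  apply: le_trans (@avoid_prob_ge h n.+1 i K i.+2 (ltW h0) iy).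
  have := @trans_approx h n.+1 i 1 (avoid_prob h n.+1 ^~ K) h0 ilt.
  rewrite mulr1 distrC => H.
  have {}H : `| avoid_prob h n.+1 i K + h * generator (avoid_prob h n.+1 ^~ K) i -
     \sum_(0 <= j < i.+2) trans h i j * avoid_prob h n.+1 j K | <= h * gen_error h n.+1.
    apply: H => j _.
    by rewrite ger0_norm ?avoid_prob_ge0 ?avoid_prob_le1.
  have := le_trans (ler_norm _) H; lra.
apply: (@le_trans _ _ (\sum_(0 <= i < n.+1) pi_ i * (avoid_prob h n.+1 i K
    + h * generator (avoid_prob h n.+1 ^~ K) i - h * gen_error h n.+1))); last first.
  rewrite !big_nat ler_sum// => i /andP[_ ilt].
  by rewrite ler_pM2l ?bd_pi_gt0// step.
under [leRHS]eq_bigr do rewrite mulrBr mulrDr.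
rewrite sumrB big_split/=.
under [X in _ <= _ + X - _]eq_bigr do rewrite mulrCA.
rewrite -mulr_sumr generator_flux -mulr_suml avoid_prob_target sub0r.
rewrite /occupation (@big_nat_recr _ _ _ K 0)//=.
move: IH; rewrite /occupation -natr1.
lra.
Qed.

(** * Skeleton hitting times and their continuous-time limit *)

(** The events [avoid h y l] decrease in [l], so the sum counts the grid points before the first
    grid visit, with cutoff [K]. *)
Definition hit_trunc (h : R) (y K : nat) (w : Omega) : R :=
  h * \sum_(0 <= l < K) \1_(avoid h y l) w.

Lemma integral_hit_trunc h y i K : 0 <= h ->
  (\int[Pr i]_w (hit_trunc h y K w)%:E = (occupation h y i K)%:E)%E.
Proof.
move=> h0.
have mI l : measurable_fun setT (fun w => (\1_(avoid h y l) w : R)%:E).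
  by apply/measurable_EFinP; apply: measurable_indic; exact: measurable_avoid.
under eq_integral do rewrite /hit_trunc EFinM -sumEFin.
rewrite ge0_integralZl_EFin//; last 2 first.
- by move=> w _; apply: sume_ge0 => l _; rewrite lee_fin.
- by apply: emeasurable_sum.
rewrite ge0_integral_sum//.
rewrite /occupation EFinM -sumEFin; congr (_ * _)%E.
apply: eq_bigr => l _; rewrite integral_indic//; last exact: measurable_avoid.
by rewrite setIT fineK// fin_num_measure//; exact: measurable_avoid.
Qed.

Lemma hit_trunc_le h y K w : 0 <= h -> hit_trunc h y K w <= h * K%:R.
Proof.
move=> h0; rewrite ler_wpM2l//.
apply: (@le_trans _ _ (\sum_(0 <= l < K) 1)); last by rewrite sumr_const_nat subn0.
by apply: ler_sum => l _; rewrite indicE; case: (_ \in _).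
Qed.

Lemma hit_trunc_ge0 h y K w : 0 <= h -> 0 <= hit_trunc h y K w.
Proof. by move=> h0; rewrite mulr_ge0// sumr_ge0. Qed.

Lemma hitting_time_ge0 y w : (0 <= hitting_time X y w)%E.
Proof. by apply/ereal_infP => _ [t [t0 _] <-]; rewrite lee_fin. Qed.

(** A grid visit is a visit, so the skeleton never hits before the chain. Once it has hit by step
    [K], raising the cutoff changes neither side. *)
Lemma min_hitting_le_hit_trunc h y K w : 0 < h ->
  (Order.min (hitting_time X y w) (h * K%:R)%:E <= (hit_trunc h y K w)%:E)%E.
Proof.
move=> h0; elim: K => [|K IH].
  by rewrite /hit_trunc big_geq// !mulr0 ge_min lexx orbT.
have [avK|navK] := pselect (avoid h y K w).
  rewrite ge_min; apply/orP; right; rewrite lee_fin ler_pM2l//.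
  rewrite -[in leLHS](subn0 K.+1) -sumr_const_nat !big_nat ler_sum// => l /andP[_ lK].
  rewrite indicE mem_set//= => r rl.
  by apply: avK; apply: leq_trans rl _; rewrite -ltnS.
have -> : hit_trunc h y K.+1 w = hit_trunc h y K w.
  by rewrite /hit_trunc big_nat_recr//= indicE memNset// addr0.
apply: le_trans IH.
have tauK : (hitting_time X y w <= (h * K%:R)%:E)%E.
  move/existsNP: navK => [r] /not_implyP[rK] /contrapT Xr.
  apply: (@le_trans _ _ (r%:R * h)%:E).
    apply: ereal_inf_lbound; exists (r%:R * h) => //; split=> //.
    exact: mulr_ge0 (ltW h0).
  by rewrite lee_fin mulrC ler_pM2l// ler_nat.
by rewrite [leRHS]min_l// ge_min lexx.
Qed.

(** A stay at [y] longer than one mesh contains a grid point no later than [t + h]. *)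
Lemma hit_trunc_le_window h y K w t e : 0 < h -> h < e -> 0 <= t ->
  (forall s, t <= s < t + e -> X s w = y) -> hit_trunc h y K w <= t + h.
Proof.
move=> h0 he t0 Xy.
have [r [tr rt]] : exists r : nat, t <= r%:R * h /\ r%:R * h <= t + h.
  (* The first grid point strictly after [t]. *)
  exists (Num.truncn (t / h)).+1.
  have /truncn_itv/andP[lo hi] : 0 <= t / h by rewrite divr_ge0// ltW.
  split; first by rewrite -ler_pdivrMr// ltW.
  by rewrite -natr1 mulrDl mul1r lerD2r -ler_pdivlMr.
apply: (@le_trans _ _ (h * r%:R)); last by rewrite mulrC.
rewrite ler_pM2l//.
apply: (@le_trans _ _ (\sum_(0 <= l < K) (l < r)%N%:R)).
  apply: ler_sum => l _; rewrite indicE.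
  have [//|rl] := ltnP l r; first by case: (_ \in _).
  rewrite memNset// => /(_ r rl); apply.
  by apply: Xy; rewrite tr (le_lt_trans rt)// ltrD2l.
rewrite -natr_sum ler_nat.
suff -> : (\sum_(0 <= l < K) (l < r) = minn K r)%N by exact: geq_minr.
elim: K => [|K IH]; first by rewrite big_geq// min0n.
by rewrite big_nat_recr//= IH; lia.
Qed.

Lemma mesh_gt0 (T : R) m : 0 < T -> 0 < T / m.+1%:R.
Proof. by move=> T0; rewrite divr_gt0. Qed.

Lemma mesh_cvg0 (T : R) : T / m.+1%:R @[m --> \oo] --> 0.
Proof.
have := cvgM (cvg_cst T) (@cvg_harmonic R).
by rewrite mulr0; apply.
Qed.

Lemma gen_error_mesh T N : 0 < T ->
  gen_error (T / m.+1%:R) N @[m --> \oo] --> 0.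
Proof.
move=> T0.
have /cvg_at_rightP := gen_error_cvg0 N; apply.
by split; [move=> m; exact: mesh_gt0|exact: mesh_cvg0].
Qed.

Lemma hit_trunc_cvg (T : R) y w : 0 < T ->
  ((hit_trunc (T / m.+1%:R) y m.+1 w)%:E @[m --> \oo]
    --> Order.min (hitting_time X y w) T%:E)%E.
Proof.
move=> T0.
have meshT m : T / m.+1%:R * m.+1%:R = T by rewrite divfK.
have lower m : (Order.min (hitting_time X y w) T%:E <=
    (hit_trunc (T / m.+1%:R) y m.+1 w)%:E)%E.
  by rewrite -{1}(meshT m) min_hitting_le_hit_trunc// mesh_gt0.
have tau0 := hitting_time_ge0 y w.
have [Ttau|tauT] := Order.TotalTheory.leP T%:E (hitting_time X y w).
  rewrite min_r// in lower *.
  apply: cvg_near_cst; apply: nearW => m; apply/eqP; rewrite eq_le lower andbT.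
  by rewrite lee_fin -[leRHS](meshT m) hit_trunc_le// ltW// mesh_gt0.
rewrite min_l in lower *; last exact: ltW.
have tfin : hitting_time X y w \is a fin_num.
  by rewrite fin_real// (lt_le_trans _ tau0)// (lt_trans tauT)// ltry.
move: (tfin); set t := fine (hitting_time X y w).
move=> /fineK tE; rewrite -tE in lower tau0 *.
rewrite lee_fin -/t in tau0.
(* Right-continuity keeps the path constant on a window after the hitting time [t]. As [t] is an
   infimum, some visit to [y] falls in the window, so the constant value is [y]. *)
have := bd_rightcont chainX w tau0.
rewrite near_withinE => -[e /= e0 He].
have Hconst s : t <= s < t + e -> X s w = X t w.
  move=> /andP[]; rewrite le_eqVlt => /predU1P[->//|ts] se.
  by apply: He => //=; rewrite distrC gtr0_norm ?subr_gt0// ltrBlDl.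
have [s [s0 Xs] st] : exists2 s, 0 <= s /\ X s w = y & s < t + e.
  have : (hitting_time X y w < (t + e)%:E)%E by rewrite -tE lte_fin ltrDl.
  by move=> /ereal_inf_lt[_ [s [s0 Xs] <-]]; rewrite lte_fin => ?; exists s.
have ts : t <= s.
  by rewrite -lee_fin tE; apply: ereal_inf_lbound; exists s.
have Xt : X t w = y by rewrite -Xs Hconst// ts.
apply: cvg_EFin; first by apply: nearW.
apply: (@squeeze_cvgr _ _ _ _ (cst t) (fun m => t + T / m.+1%:R)); last 2 first.
- exact: cvg_cst.
- by have := cvgD (cvg_cst t) (mesh_cvg0 T); rewrite addr0; apply.
have /cvgr_lt/(_ _ e0) := mesh_cvg0 T.
apply: filterS => m me.
rewrite -lee_fin lower/= (hit_trunc_le_window _ _ _ _ _ e)//; first exact: mesh_gt0.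
by move=> u /Hconst ->.
Qed.

Lemma measurable_hit_trunc h y K :
  measurable_fun setT (fun w => (hit_trunc h y K w)%:E).
Proof.
apply/measurable_EFinP; apply: measurable_funM => //.
apply: measurable_sum => l; apply: measurable_indic; exact: measurable_avoid.
Qed.

(** The infimum runs over uncountably many times; measurability comes from the pointwise limit of
    the skeleton versions. *)
Lemma measurable_min_hitting T y : 0 < T ->
  measurable_fun setT (fun w => Order.min (hitting_time X y w) T%:E).
Proof.
move=> T0.
apply: (@emeasurable_fun_cvg _ _ _ _ (fun m w => (hit_trunc (T / m.+1%:R) y m.+1 w)%:E)).
  by move=> m; exact: measurable_hit_trunc.
by move=> w _; exact: hit_trunc_cvg.
Qed.

Lemma occupation_cvg T y i : 0 < T ->
  ((occupation (T / m.+1%:R) y i m.+1)%:E @[m --> \oo] -->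
   \int[Pr i]_w Order.min (hitting_time X y w) T%:E)%E.
Proof.
move=> T0.
have := @dominated_convergence _ _ _ (Pr i) setT measurableT
  (fun m w => (hit_trunc (T / m.+1%:R) y m.+1 w)%:E)
  (fun w => Order.min (hitting_time X y w) T%:E) (cst T%:E).
case.
- by move=> m; exact: measurable_hit_trunc.
- exact: measurable_min_hitting.
- by apply: aeW => w _; exact: hit_trunc_cvg.
- exact: finite_measure_integrable_cst.
- apply: aeW => w m _ /=.
  have h0 := ltW (mesh_gt0 T m T0).
  rewrite lee_fin ger0_norm ?hit_trunc_ge0//.
  by apply: le_trans (hit_trunc_le _ _ _ _ h0) _; rewrite divfK.
move=> _ _; apply: cvg_trans; apply: near_eq_cvg; apply: nearW => m /=.
by rewrite integral_hit_trunc// ltW// mesh_gt0.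
Qed.

Lemma min_hitting_cvg y w :
  (Order.min (hitting_time X y w) n.+1%:R%:E @[n --> \oo] --> hitting_time X y w)%E.
Proof.
have := hitting_time_ge0 y w; case: (hitting_time X y w) => [t _| _|//].
  apply: cvg_near_cst; exists (Num.truncn t) => // n /= tn.
  rewrite min_l// lee_fin.
  by apply: le_trans (ltW (truncnS_gt t)) _; rewrite ler_nat ltnS.
under eq_fun do rewrite min_r ?leey//.
by apply/cvgenyP => A [N _ HA]; exists N => // n /= Nn; apply: HA; exact: leqW.
Qed.

Lemma min_hitting_ge0 y n w :
  (0 <= Order.min (hitting_time X y w) n.+1%:R%:E)%E.
Proof. by rewrite le_min hitting_time_ge0 lee_fin ler0n. Qed.

Lemma mean_hitting_time_le i y (B : \bar R) :
  (forall T : R, (0 < T)%R -> \int[Pr i]_w Order.min (hitting_time X y w) T%:E <= B)%E ->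
  (mean_hitting_time Pr X i y <= B)%E.
Proof.
move=> HB.
have nd w : {homo (fun n => Order.min (hitting_time X y w) n.+1%:R%:E) :
    m n / (m <= n)%N >-> (m <= n)%E}.
  move=> m n mn; rewrite le_min ge_min lexx/= ge_min; apply/orP; right.
  by rewrite lee_fin ler_nat.
have -> : mean_hitting_time Pr X i y =
    limn (fun n => \int[Pr i]_w Order.min (hitting_time X y w) n.+1%:R%:E)%E.
  rewrite -monotone_convergence//.
  - by apply: eq_integral => w _; apply/esym/cvg_lim => //; exact: min_hitting_cvg.
  - by move=> n; exact: measurable_min_hitting.
  - by move=> n w _; exact: min_hitting_ge0.
apply: lime_le; last by apply: nearW => n; exact: HB.
apply: ereal_nondecreasing_is_cvgn => m n mn; apply: ge0_le_integral => //.
- by move=> w _; exact: min_hitting_ge0.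
- exact: measurable_min_hitting.
- exact: measurable_min_hitting.
- by move=> w _; exact: nd.
Qed.

Lemma min_hitting_le_mean i y (T : R) : 0 < T ->
  (\int[Pr i]_w Order.min (hitting_time X y w) T%:E <= mean_hitting_time Pr X i y)%E.
Proof.
move=> T0; apply: ge0_le_integral => //.
- by move=> w _; rewrite le_min hitting_time_ge0 lee_fin ltW.
- exact: measurable_min_hitting.
- apply: (@emeasurable_fun_cvg _ _ _ _
    (fun n w => Order.min (hitting_time X y w) n.+1%:R%:E)).
    by move=> n; exact: measurable_min_hitting.
  by move=> w _; exact: min_hitting_cvg.
- by move=> w _; rewrite ge_min lexx.
Qed.

(** * Supersolution bounds on mean hitting times *)

(** The disjunction is the boundary condition at [N]: the occupation vanishes there if [N] is the
    target, and otherwise is at most the horizon [T <= v N]. The sum of [v] over the block serves as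
    the bound [V]. *)
Lemma occupation_mesh_le y N T (v : nat -> R) m i : 0 < T ->
  (forall j, 0 <= v j) ->
  (forall j, (j < N)%N -> j != y -> generator v j <= -1) ->
  N = y \/ T <= v N -> (i <= N)%N ->
  occupation (T / m.+1%:R) y i m.+1 <=
    v i + T * (gen_error (T / m.+1%:R) N * (\sum_(0 <= j < N.+1) v j + T)).
Proof.
move=> T0 v0 gen_v vN iN.
have h0 := mesh_gt0 T m T0.
have hK : T / m.+1%:R * m.+1%:R = T by rewrite divfK.
have := @occupation_supersolution (T / m.+1%:R) y N m.+1
  (\sum_(0 <= j < N.+1) v j) T v h0 _ gen_v _ _ m.+1 i (leqnn _) iN.
rewrite hK; apply => //.
- move=> j jN; rewrite v0/=.
  rewrite big_mkord (bigD1 (Ordinal (jN : (j < N.+1)%N)))//= lerDl.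
  by apply: sumr_ge0.
- move=> k kK; case: vN => [->|TvN].
    by rewrite /occupation big1 ?mulr0// => l _; exact: avoid_prob_target.
  apply: le_trans (occupation_le _ _ _ _ (ltW h0)) _; apply: le_trans TvN.
  by rewrite -[leRHS]hK ler_pM2l// ler_nat.
Qed.

Lemma min_hitting_supersolution y N T (v : nat -> R) i : 0 < T ->
  (forall j, 0 <= v j) ->
  (forall j, (j < N)%N -> j != y -> generator v j <= -1) ->
  N = y \/ T <= v N -> (i <= N)%N ->
  (\int[Pr i]_w Order.min (hitting_time X y w) T%:E <= (v i)%:E)%E.
Proof.
move=> T0 v0 gen_v vN iN.
have Hle m := occupation_mesh_le y N T v m i T0 v0 gen_v vN iN.
have C1 := occupation_cvg T y i T0.
set W := \sum_(0 <= j < N.+1) v j + T in Hle.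
have C2 : (v i + T * (gen_error (T / m.+1%:R) N * W))%:E @[m --> \oo] --> (v i)%:E.
  apply: cvg_EFin; first exact: nearW.
  have := cvgD (cvg_cst (v i)) (cvgM (cvg_cst T)
    (cvgM (gen_error_mesh T N T0) (cvg_cst W))).
  by rewrite mul0r mulr0 addr0; apply.
rewrite -(cvg_lim (@ereal_hausdorff R) C1) -(cvg_lim (@ereal_hausdorff R) C2).
apply: lee_lim; [exact: cvgP C1|exact: cvgP C2|].
by apply: nearW => m; rewrite lee_fin.
Qed.

(** * Closed form of the mean upward passage time *)

Definition pi_sum n := \sum_(0 <= j < n.+1) pi_ j.

Definition mean_up n := pi_sum n / (lambda n * pi_ n).

Lemma pi_sumS n : pi_sum n.+1 = pi_sum n + pi_ n.+1.
Proof. by rewrite /pi_sum big_nat_recr. Qed.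

Lemma pi_sum_gt0 n : 0 < pi_sum n.
Proof.
rewrite /pi_sum big_nat_recr//= ltr_wpDl ?bd_pi_gt0// sumr_ge0// => j _.
by rewrite ltW// bd_pi_gt0.
Qed.

Lemma mean_up_gt0 n : 0 < mean_up n.
Proof. by rewrite divr_gt0 ?pi_sum_gt0// mulr_gt0// bd_pi_gt0. Qed.

(** The function is the mean time to climb from [j] to [n.+1]. For [i > 0], after multiplication by
    [pi_ i], the up-step contributes [- pi_sum i] and the down-step, by detailed balance,
    [pi_sum i.-1]; their sum is [- pi_ i]. *)
Lemma generator_up n i : (i < n.+1)%N ->
  generator (fun j => \sum_(j <= k < n.+1) mean_up k) i = -1.
Proof.
move=> ilt; rewrite /generator.
have pi_neq0 k : pi_ k != 0 by rewrite gt_eqF// bd_pi_gt0.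
have la_neq0 k : lambda k != 0 by rewrite gt_eqF.
rewrite [\sum_(i <= k < _) _]big_ltn//.
case: i ilt => [|i] ilt.
  rewrite mu0 mul0r addr0 /mean_up /pi_sum big_nat1.
  by field; rewrite la_neq0 pi_neq0.
rewrite /= [\sum_(i <= k < _) _]big_ltn; last exact: ltnW.
rewrite [\sum_(i.+1 <= k < _) _]big_ltn//.
have -> : mu i.+1 = lambda i * pi_ i / pi_ i.+1.
  by rewrite -bd_pi_balance mulfK.
rewrite /mean_up pi_sumS.
by field; rewrite !la_neq0 !pi_neq0.
Qed.

Lemma T_plusE n : T_plus Pr X n = (mean_up n)%:E.
Proof.
pose v j := \sum_(j <= k < n.+1) mean_up k.
have v0 j : 0 <= v j by apply: sumr_ge0 => k _; rewrite ltW// mean_up_gt0.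
have gen_v j : (j < n.+1)%N -> j != n.+1 -> generator v j <= -1.
  by move=> jn _; rewrite generator_up.
have vn : v n = mean_up n by rewrite /v big_nat1.
have vN T : n.+1 = n.+1 \/ T <= v n.+1 by left.
have upper : (T_plus Pr X n <= (mean_up n)%:E)%E.
  apply: mean_hitting_time_le => T T0; rewrite -vn.
  exact: (min_hitting_supersolution n.+1 n.+1 T v n T0 v0 gen_v (vN T)).
(* By Markov's inequality, the mass surviving at time [T] is at most [C / T] up to mesh error; the
   rest has left through [n], which bounds the passage time from below. *)
pose C := \sum_(0 <= i < n.+1) pi_ i * v i.
have lapi0 : 0 < lambda n * pi_ n by rewrite mulr_gt0// bd_pi_gt0.
have lower T : 0 < T -> (((pi_sum n - C / T) / (lambda n * pi_ n))%:E <= T_plus Pr X n)%E.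
  move=> T0; apply: le_trans (min_hitting_le_mean n n.+1 T T0).
  have C1 := occupation_cvg T n.+1 n T0.
  pose e m := gen_error (T / m.+1%:R) n.+1.
  pose W := \sum_(0 <= j < n.+2) v j + T.
  (* The factor of [e m] collects [T * pi_sum n] from the flux estimate and [pi_sum n * W] from
     Markov's inequality. *)
  pose b m := (pi_sum n - C / T - e m * (T * pi_sum n + pi_sum n * W))
    / (lambda n * pi_ n).
  have C2 : (b m)%:E @[m --> \oo] --> ((pi_sum n - C / T) / (lambda n * pi_ n))%:E.
    apply: cvg_EFin; first exact: nearW.
    have := cvgM (cvgB (cvg_cst (pi_sum n - C / T)) (cvgM (gen_error_mesh T n.+1 T0)
      (cvg_cst (T * pi_sum n + pi_sum n * W)))) (cvg_cst (lambda n * pi_ n)^-1).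
    by rewrite mul0r subr0; apply.
  rewrite -(cvg_lim (@ereal_hausdorff R) C1) -(cvg_lim (@ereal_hausdorff R) C2).
  apply: lee_lim; [exact: cvgP C2|exact: cvgP C1|].
  apply: nearW => m; rewrite lee_fin /b ler_pdivrMr//.
  have h0 := mesh_gt0 T m T0.
  have hK : T / m.+1%:R * m.+1%:R = T by rewrite divfK.
  have flux := @avoid_flux_ge (T / m.+1%:R) n m.+1 h0.
  have avoid_le i : (i < n.+1)%N ->
      avoid_prob (T / m.+1%:R) n.+1 i m.+1 <= v i / T + e m * W.
    move=> ilt.
    have A1 := avoid_prob_le_occupation (T / m.+1%:R) n.+1 i m.+1 (ltW h0).
    have A2 := occupation_mesh_le n.+1 n.+1 T v m i T0 v0 gen_v (vN T) (ltnW ilt).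
    have := le_trans A1 A2; rewrite hK -/(e m) -/W => A3.
    rewrite -(ler_pM2l T0); apply: le_trans A3 _.
    rewrite le_eqVlt; apply/orP; left; apply/eqP.
    by field; rewrite gt_eqF.
  have sum_le : \sum_(0 <= i < n.+1) pi_ i * avoid_prob (T / m.+1%:R) n.+1 i m.+1
      <= C / T + pi_sum n * (e m * W).
    apply: (@le_trans _ _ (\sum_(0 <= i < n.+1) pi_ i * (v i / T + e m * W))).
      rewrite !big_nat ler_sum// => i /andP[_ ilt].
      by rewrite ler_pM2l ?bd_pi_gt0// avoid_le.
    under eq_bigr do rewrite mulrDr mulrA.
    by rewrite big_split/= -!mulr_suml.
  have := le_trans flux sum_le; rewrite hK -/(pi_sum n) -/(e m).
  lra.
have fin : T_plus Pr X n \is a fin_num.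
  rewrite fin_real//; apply/andP; split; last exact: le_lt_trans upper (ltry _).
  exact: lt_le_trans (ltNyr _) (lower 1 ltr01).
apply/eqP; rewrite eq_le upper/= -(fineK fin) lee_fin.
(* The lower bound is used along [T = m.+1], where [C / T] is [C * harmonic m]. *)
have C3 : (pi_sum n - C * harmonic m) / (lambda n * pi_ n) @[m --> \oo] --> mean_up n.
  have := cvgM (cvgB (cvg_cst (pi_sum n)) (cvgM (cvg_cst C) (@cvg_harmonic R)))
    (cvg_cst (lambda n * pi_ n)^-1).
  by rewrite mulr0 subr0; apply.
rewrite -(cvg_lim (@Rhausdorff R) C3); apply: limr_le; first exact: cvgP C3.
by apply: nearW => m; rewrite -lee_fin (fineK fin); apply: lower.
Qed.

(** * Recurrence and the mean time to reach 0 *)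

Local Notation pi_total := (limn (series pi_)).

Hypothesis recurrent : series (fun n => 1 / (lambda n * pi_ n)) @ \oo --> +oo.
Hypothesis pi_summable : cvgn (series pi_).

Lemma pi_sum_le n : pi_sum n <= pi_total.
Proof.
apply: (nondecreasing_cvgn_le _ pi_summable n.+1).
by apply: nondecreasing_series => k _ _; rewrite ltW// bd_pi_gt0.
Qed.

(** The increment numerators drop by [pi_ i] from index [i.-1] to [i], whatever [e] is: the [e] part
    is a multiple of the scale function, harmonic off 0. *)
Lemma generator_down e i : (0 < i)%N ->
  generator (fun j => \sum_(0 <= k < j) (pi_total - pi_sum k + e) / (lambda k * pi_ k))
    i = -1.
Proof.
case: i => // i _; rewrite /generator /=.
have pi_neq0 k : pi_ k != 0 by rewrite gt_eqF// bd_pi_gt0.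
have la_neq0 k : lambda k != 0 by rewrite gt_eqF.
rewrite !big_nat_recr//=.
have -> : mu i.+1 = lambda i * pi_ i / pi_ i.+1.
  by rewrite -bd_pi_balance mulfK.
rewrite pi_sumS.
by field; rewrite !la_neq0 !pi_neq0.
Qed.

(* Adding [e] times the scale function, which is unbounded by recurrence, makes
   the supersolution exceed [T] outside a finite block. *)
Lemma mean_hitting_time0_le i :
  (mean_hitting_time Pr X i 0 <=
   (\sum_(0 <= k < i) (pi_total - pi_sum k) / (lambda k * pi_ k))%:E)%E.
Proof.
apply: mean_hitting_time_le => T T0.
apply/lee_addgt0Pr => d0 d0_gt0.
pose s := \sum_(0 <= k < i) (lambda k * pi_ k)^-1.
have lapi0 k : 0 < lambda k * pi_ k by rewrite mulr_gt0// bd_pi_gt0.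
have s0 : 0 <= s by apply: sumr_ge0 => k _; rewrite invr_ge0 ltW.
(* This gives [e * s <= d0]; the added 1 keeps the divisor positive when [i = 0]. *)
pose e := d0 / (s + 1).
have e0 : 0 < e by rewrite divr_gt0// ltr_wpDl.
pose v j := \sum_(0 <= k < j) (pi_total - pi_sum k + e) / (lambda k * pi_ k).
have term_ge k : e / (lambda k * pi_ k) <= (pi_total - pi_sum k + e) / (lambda k * pi_ k).
  by rewrite ler_pM2r ?invr_gt0// lerDr subr_ge0 pi_sum_le.
have term0 k : 0 <= (pi_total - pi_sum k + e) / (lambda k * pi_ k).
  by apply: le_trans (term_ge k); rewrite divr_ge0// ltW.
have v0 j : 0 <= v j by apply: sumr_ge0.
(* Each increment of [v] is at least [e] times a term of the divergent series, so a partial sum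
   above [T / e] suffices. *)
have [N iN TvN] : exists2 N, (i <= N)%N & T <= v N.
  have /cvgryPge/(_ (T / e)) [N _ HN] := recurrent.
  exists (maxn i N); first exact: leq_maxl.
  have := HN (maxn i N) (leq_maxr _ _).
  rewrite ler_pdivrMr// => /le_trans; apply.
  rewrite /series/= mulr_suml; apply: ler_sum => k _.
  by apply: le_trans (term_ge k); rewrite mulrAC mul1r.
have gen_v j : (j < N)%N -> j != 0%N -> generator v j <= -1.
  by move=> _; rewrite -lt0n => j0; rewrite generator_down.
apply: le_trans (min_hitting_supersolution 0 N T v i T0 v0 gen_v (or_intror TvN) iN) _.
rewrite -EFinD lee_fin /v.
under eq_bigr do rewrite mulrDl.
rewrite big_split/= lerD2l -mulr_sumr -/s /e mulrAC ler_pdivrMr ?ltr_wpDl//.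
by rewrite ler_pM2l// lerDl.
Qed.

End grid_chain.

(** * Dependence of the recurrence on [z], and divergence of the variance *)

Section proposition.
Context (R : realType) (lambda mu : nat -> R).
Hypothesis lambda_gt0 : forall n, 0 < lambda n.
Hypothesis mu_gt0 : forall n, 0 < mu n.+1.
Hypothesis pi_summable : cvgn (series (bd_pi lambda mu)).

Local Notation pi_ := (bd_pi lambda mu).
Local Notation pi_total := (limn (series pi_)).
Local Notation S := (pi_sum R lambda mu).
Local Notation t := (mean_up R lambda mu).

Let pi_gt0 n : 0 < pi_ n.
Proof. exact: bd_pi_gt0. Qed.

Lemma pi_sum_ge1 n : 1 <= S n.
Proof.
have pi0 : pi_ 0%N = 1 by rewrite /bd_pi !big_geq// divr1.
rewrite /pi_sum big_nat_recl// pi0 lerDl.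
by apply: sumr_ge0 => k _; rewrite ltW// pi_gt0.
Qed.

Lemma pi_total_gt0 : 0 < pi_total.
Proof.
apply: lt_le_trans (pi_sum_gt0 _ _ _ lambda_gt0 mu_gt0 0) _.
exact: pi_sum_le.
Qed.

Lemma bd_PE n : bd_P lambda mu n = S n / pi_total.
Proof. by rewrite /bd_P /bd_p -mulr_suml. Qed.

Lemma bd_PbarE n : bd_Pbar lambda mu n = (pi_total - S n) / pi_total.
Proof. by rewrite /bd_Pbar bd_PE mulrBl divff// gt_eqF// pi_total_gt0. Qed.

Lemma bd_Pbar_ge0 n : 0 <= bd_Pbar lambda mu n.
Proof.
by rewrite bd_PbarE divr_ge0// ?subr_ge0 ?pi_sum_le// ltW// pi_total_gt0.
Qed.

(** In the expanded square of [fwd], this turns the weights [lambda n * bd_p lambda mu n] of the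
    variance into [bd_P], in both the cross term and the quadratic term. *)
Lemma lambda_p_mean_up n : lambda n * bd_p lambda mu n * t n = bd_P lambda mu n.
Proof.
rewrite bd_PE /bd_p /mean_up; field.
by rewrite !gt_eqF// pi_total_gt0.
Qed.

(** The recurrence is affine in [z], and by detailed balance [mean_up] solves its linear part with
    source [1 / lambda n]. *)
Lemma fwd_diff c z z' n : fwd lambda mu c z' n = fwd lambda mu c z n + (z' - z) * t n.
Proof.
elim: n => [|n IH] /=.
  rewrite /mean_up /pi_sum big_nat1.
  by field; rewrite !gt_eqF.
rewrite IH /mean_up pi_sumS.
have -> : mu n.+1 = lambda n * pi_ n / pi_ n.+1.
  by rewrite -bd_pi_balance// mulfK// gt_eqF.
by field; rewrite !gt_eqF.
Qed.

Lemma beta0_trunc_diff c z z' N :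
  beta0_trunc lambda mu c z' N = beta0_trunc lambda mu c z N
    - (z' - z) * \sum_(0 <= n < N.+1) bd_Pbar lambda mu n * t n.
Proof.
rewrite /beta0_trunc; under eq_bigr do rewrite (fwd_diff c z) mulrDr mulrCA.
by rewrite big_split/= -mulr_sumr opprD.
Qed.

Lemma sigma2_trunc_diff c z z' N :
  sigma2_trunc lambda mu c z' N = sigma2_trunc lambda mu c z N
    + 4 * (z' - z) * \sum_(0 <= n < N.+1) bd_P lambda mu n * fwd lambda mu c z n
    + 2 * (z' - z) ^+ 2 * \sum_(0 <= n < N.+1) bd_P lambda mu n * t n.
Proof.
rewrite /sigma2_trunc !mulr_sumr -!big_split/=; apply: eq_bigr => n _.
by rewrite (fwd_diff c z) -lambda_p_mean_up; ring.
Qed.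

(** Each term is [pi_sum n ^+ 2 / (lambda n * pi_ n * pi_total)], and [pi_sum n >= 1] because state
    0 has weight 1; so the recurrence series divided by [pi_total] is a minorant. *)
Lemma mean_up_sum_dvg :
  series (fun n => 1 / (lambda n * pi_ n)) @ \oo --> +oo ->
  (fun N => \sum_(0 <= n < N.+1) bd_P lambda mu n * t n) @ \oo --> +oo.
Proof.
move=> recurrent; apply/cvgryPge => A.
have /cvgryPge/(_ (A * pi_total)) [N _ HN] := recurrent.
exists N => // m /= Nm; have := HN m.+1 (leqW Nm).
rewrite -ler_pdivlMr ?pi_total_gt0// => /le_trans; apply.
rewrite /series/= mulr_suml; apply: ler_sum => n _.
rewrite bd_PE /mean_up.
rewrite (_ : S n / _ * _ = (S n * S n) / (lambda n * pi_ n) / pi_total); last first.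
  by field; rewrite !gt_eqF// pi_total_gt0.
have la0 : 0 < lambda n * pi_ n by rewrite mulr_gt0.
rewrite ler_pM2r; last by rewrite invr_gt0 pi_total_gt0.
rewrite ler_pM2r; last by rewrite invr_gt0.
by rewrite mulr_ege1// pi_sum_ge1.
Qed.

(** The cross sum in [sigma2_trunc_diff] has no controlled sign; a termwise lower bound replaces the
    identity, with the convergent variance at [z] absorbing the cross term. *)
Lemma sigma2_trunc_dvg c z z' (sigma2 : R) : z' != z ->
  series (fun n => 1 / (lambda n * pi_ n)) @ \oo --> +oo ->
  sigma2_trunc lambda mu c z @ \oo --> sigma2 ->
  sigma2_trunc lambda mu c z' @ \oo --> +oo.
Proof.
move=> zz' recurrent cvg2.
have E2 : 0 < (z' - z) ^+ 2 by rewrite exprn_even_gt0//= subr_eq0.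
have bound N : (z' - z) ^+ 2 * (\sum_(0 <= n < N.+1) bd_P lambda mu n * t n)
    - sigma2_trunc lambda mu c z N <= sigma2_trunc lambda mu c z' N.
  rewrite lerBlDr /sigma2_trunc !mulr_sumr -big_split/=.
  apply: ler_sum => n _.
  rewrite (fwd_diff c z) -lambda_p_mean_up.
  set p := lambda n * bd_p lambda mu n; set f := fwd _ _ _ _ _; set s := t n.
  have p0 : 0 <= p.
    by rewrite mulr_ge0 ?(ltW (lambda_gt0 n))// divr_ge0// ltW// pi_total_gt0.
  rewrite -subr_ge0.
  (* With [E = z' - z], the gap is a perfect square: [2 (f + E s)^2 + 2 f^2 - (E s)^2 = (2 f + E
     s)^2]. *)
  rewrite (_ : _ - _ = p * (2 * f + (z' - z) * s) ^+ 2); last by ring.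
  by rewrite mulr_ge0// sqr_ge0.
apply/cvgryPge => A.
have /cvgryPge/(_ ((A + (sigma2 + 1)) / (z' - z) ^+ 2)) := mean_up_sum_dvg recurrent.
have /cvgr_lt/(_ (sigma2 + 1)) := cvg2; rewrite ltrDl => /(_ ltr01).
apply: filterS2 => N sig; rewrite ler_pdivrMr// => big.
apply: le_trans (bound N); lra.
Qed.

End proposition.

(** * The four claims on the perturbed bias and variance *)

Theorem proposition5p5 (R : realType) (d : measure_display)
    (Omega : measurableType d) (lambda mu c : nat -> R)
    (Pr : nat -> probability Omega R) (X : R -> {mfun Omega >-> nat})
    (lambda_gt0 : forall n, 0 < lambda n)
    (mu_gt0 : forall n, 0 < mu n.+1)
    (mu0 : mu 0%N = 0)
    (chainX : birth_death_chain lambda mu Pr X)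
    (recurrent : series (fun n => 1 / (lambda n * bd_pi lambda mu n)) @ \oo
                   --> +oo)
    (pi_summable : cvgn (series (bd_pi lambda mu)))
    (c_summable : cvgn (series (fun n => `|c n| * bd_p lambda mu n)))
    (zetahat : R) (zetahat_neq : zetahat <> mean_cost lambda mu c)
    (beta0 sigma2 : R)
    (beta0_cvg : beta0_trunc lambda mu c (mean_cost lambda mu c) @ \oo
                   --> beta0)
    (sigma2_cvg : sigma2_trunc lambda mu c (mean_cost lambda mu c) @ \oo
                    --> sigma2) :
  let zeta := mean_cost lambda mu c in
  let phi := fwd lambda mu c zeta in
  let betaN := beta0_trunc lambda mu c zeta in
  let sigma2N := sigma2_trunc lambda mu c zeta in
  let betahatN := beta0_trunc lambda mu c zetahat in
  let sigma2hatN := sigma2_trunc lambda mu c zetahat in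
  let Eabs := zetahat - zeta in
  let P := bd_P lambda mu in
  let Pbar := bd_Pbar lambda mu in
  let Tplus := T_plus Pr X in
  [/\ (* (a) *)
      forall N : nat,
        ((betahatN N)%:E
         = (betaN N)%:E
           - Eabs%:E * \sum_(0 <= n < N.+1) (Pbar n)%:E * Tplus n)%E,
      (* (b) *)
      (T_infty_0 Pr X = +oo%E -> `|betahatN N| @[N --> \oo] --> +oo) /\
      (T_infty_0 Pr X <> +oo%E ->
         (betahatN N)%:E @[N --> \oo]
           --> (beta0%:E - T_infty_p lambda mu Pr X * Eabs%:E)%E),
      (* (c) *)
      forall N : nat,
        ((sigma2hatN N)%:E
         = (sigma2N N)%:E
           + (4 * Eabs * \sum_(0 <= n < N.+1) P n * phi n)%R%:E
           + (2 * Eabs ^+ 2)%R%:E * \sum_(0 <= n < N.+1) (P n)%:E * Tplus n)%E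
    & (* (d) *)
      sigma2hatN @ \oo --> +oo].
Proof.
move=> zeta phi betaN sigma2N betahatN sigma2hatN Eabs P Pbar Tplus.
have TE n : Tplus n = (mean_up R lambda mu n)%:E by exact: T_plusE chainX _ _ _ n.
have E0 : zetahat != zeta by exact/eqP.
pose A N := \sum_(0 <= n < N.+1) Pbar n * mean_up R lambda mu n.
have AE N : (\sum_(0 <= n < N.+1) (Pbar n)%:E * Tplus n = (A N)%:E)%E.
  by rewrite -sumEFin; apply: eq_bigr => n _; rewrite TE.
have partA N : ((betahatN N)%:E = (betaN N)%:E
    - Eabs%:E * \sum_(0 <= n < N.+1) (Pbar n)%:E * Tplus n)%E.
  rewrite AE -EFinM -EFinB; congr (_%:E).
  exact: beta0_trunc_diff.
have term_ge0 n : 0 <= Pbar n * mean_up R lambda mu n.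
  by rewrite mulr_ge0 ?bd_Pbar_ge0// ltW// mean_up_gt0.
split=> //.
- split.
    move=> Tinf.
    have A_dvg : A @ \oo --> +oo.
      have ndA : nondecreasing_seq A.
        apply/nondecreasing_seqP => N.
        by rewrite /A [leRHS]big_nat_recr//= lerDl.
      (* Were [A] convergent, every mean time to 0 would be at most [Pi * limn A], against
         [Tinf]. *)
      apply: nondecreasing_dvgn_lt => // cvgA.
      set Pi := limn (series (bd_pi lambda mu)).
      have Pi0 : 0 < Pi by exact: pi_total_gt0.
      have bounded i : (mean_hitting_time Pr X i 0 <= (Pi * limn A)%:E)%E.
        have := mean_hitting_time0_le _ _ _ _ _ _ _ chainX mu0 lambda_gt0 mu_gt0
          recurrent pi_summable i.
        move=> /le_trans; apply; rewrite lee_fin.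
        have Alim : Pi * A i <= Pi * limn A.
          by rewrite ler_pM2l// nondecreasing_cvgn_le.
        apply: le_trans Alim.
        (* [A i] has one term more than the bound on the mean time from [i] to 0; it is dropped, and
           the others compare by [pi_sum n >= 1]. *)
        rewrite /A mulr_sumr big_nat_recr//= -[leLHS]addr0 lerD//; last first.
          by rewrite mulr_ge0// ltW.
        apply: ler_sum => n _.
        have lapi0 : 0 < lambda n * bd_pi lambda mu n by rewrite mulr_gt0// bd_pi_gt0.
        rewrite /Pbar bd_PbarE// /mean_up -/Pi.
        rewrite (_ : Pi * _ = (Pi - pi_sum R lambda mu n) * pi_sum R lambda mu n
          / (lambda n * bd_pi lambda mu n)); last first.
          by field; rewrite !gt_eqF// bd_pi_gt0.
        rewrite ler_pM2r ?invr_gt0// ler_peMr ?pi_sum_ge1// subr_ge0.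
        exact: pi_sum_le.
      (* A divergent sequence has a finite junk limit, so it cannot give [+oo]. *)
      have [Hcvg|Hdvg] := pselect (cvgn (fun n => mean_hitting_time Pr X n 0)).
        have : (T_infty_0 Pr X <= (Pi * limn A)%:E)%E.
          by apply: lime_le => //; exact: nearW.
        by rewrite Tinf leye_eq.
      by move: Tinf; rewrite /T_infty_0 (dvgP Hdvg).
    apply/cvgryPge => B.
    have EN : 0 < `|Eabs| by rewrite normr_gt0 subr_eq0.
    (* Since [|betaN N|] is eventually below [|beta0| + 1], the reverse triangle inequality leaves
       at least [B] once [|Eabs| * A N] exceeds [B] by that amount. *)
    have /cvgryPge/(_ ((B + (`|beta0| + 1)) / `|Eabs|)) := A_dvg.
    have bnorm : `|betaN N| @[N --> \oo] --> `|beta0| by exact: cvg_norm beta0_cvg.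
    have /cvgr_lt/(_ (`|beta0| + 1)) := bnorm; rewrite ltrDl => /(_ ltr01).
    apply: filterS2 => N bN; rewrite ler_pdivrMr// => AN.
    have -> : betahatN N = beta0_trunc lambda mu c zeta N - Eabs * A N.
      exact: beta0_trunc_diff.
    have A0 : 0 <= A N by apply: sumr_ge0 => n _.
    have := lerB_dist (Eabs * A N) (beta0_trunc lambda mu c zeta N).
    rewrite normrM (ger0_norm A0) distrC => H; apply: le_trans H.
    move: bN AN; rewrite -/zeta; lra.
  move=> _.
  have -> : (fun N => (betahatN N)%:E) = (fun N => (betaN N)%:E
      - Eabs%:E * \sum_(0 <= n < N.+1) (Pbar n)%:E * Tplus n)%E.
    by apply/funext => N; rewrite partA.
  (* The limit is taken in the extended reals, where the series of nonnegative terms always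
     converges; the difference is defined because [beta0] is finite. *)
  apply: cvgeB.
  - by [].
  - by apply: cvg_EFin => //; exact: nearW.
  rewrite muleC; apply: cvgeZl => //.
  rewrite (cvg_shiftS (fun N => \sum_(0 <= n < N) (Pbar n)%:E * Tplus n)%E).
  apply: is_cvg_nneseries => n _ _.
  by rewrite TE -EFinM lee_fin.
- move=> N.
  have -> : (\sum_(0 <= n < N.+1) (P n)%:E * Tplus n)%E
      = (\sum_(0 <= n < N.+1) P n * mean_up R lambda mu n)%:E.
    by rewrite -sumEFin; apply: eq_bigr => n _; rewrite TE.
  rewrite -!EFinM -!EFinD; congr (_%:E).
  exact: sigma2_trunc_diff.
- exact: sigma2_trunc_dvg sigma2_cvg.
Qed.
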